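(* Let $G$ be a finite group with the Sylow tower property. Then $G$ is isomorphic to the multiplicative group of a skew left brace of nilpotent type.
   Context: A finite group $G$ has the Sylow tower property if there exists a normal series $\{1\}=G_0\subseteq G_1\subseteq\dots\subseteq G_n=G$ such that $G_{i+1}/G_i$ is isomorphic to a Sylow subgroup of $G$ for all $i=0,\dots,n-1$. A skew left brace is a set $B$ with two binary operations $+$ and $\circ$ such that $(B,+)$ and $(B,\circ)$ are groups (neither necessarily abelian), called respectively the additive group and the multiplicative group of $B$, and $a\circ(b+c)=a\circ b-a+a\circ c$ for all $a,b,c\in B$. A skew left brace is of nilpotent type if its additive group $(B,+)$ is nilpotent. *)

(* Defs.v *)
From HB Require Import structures.
From mathcomp Require Import all_boot all_fingroup all_solvable.

Set Implicit Arguments.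
Unset Strict Implicit.
Unset Printing Implicit Defensive.

Local Open Scope group_scope.

(* A factor isomorphic to a trivial Sylow subgroup (for p not dividing #|G|)
   is allowed; such a factor only repeats a term of the series. *)
Definition sylow_tower_property (gT : finGroupType) (G : {group gT}) : Prop :=
  exists (n : nat) (H : nat -> {group gT}),
    [/\ H 0 :=: 1,
        H n :=: G,
        forall i, i <= n -> H i <| G,
        forall i, i < n -> H i \subset H i.+1
      & forall i, i < n -> exists (p : nat) (P : {group gT}),
          [/\ prime p, p.-Sylow(G) P & (H i.+1 / H i) \isog P]].

(* The additive group of a skew left brace is the groupType structure of its
   carrier.  MathComp writes all possibly non-abelian groups multiplicatively,
   so b * c, a^-1 and 1 stand for the b + c, -a and 0 of the brace; circ is the
   multiplicative operation. *)
HB.mixin Record Group_isSkewLeftBrace B of monoid.Group B := {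
  circ : B -> B -> B;
  circ_one : B;
  circ_inv : B -> B;
  circA : associative circ;
  circ1b : left_id circ_one circ;
  circb1 : right_id circ_one circ;
  circVb : left_inverse circ_one circ_inv circ;
  circbV : right_inverse circ_one circ_inv circ;
  circDr : forall a b c : B, circ a (b * c) = circ a b * a^-1 * circ a c
}.

#[short(type="skewLeftBraceType")]
HB.structure Definition SkewLeftBrace :=
  { B of Group_isSkewLeftBrace B & monoid.Group B }.

#[short(type="finSkewLeftBraceType")]
HB.structure Definition FinSkewLeftBrace := { B of SkewLeftBrace B & Finite B }.

(* The carrier of B, with circ as its group law. *)
Definition mult_group (B : Type) : Type := B.

HB.instance Definition _ (B : skewLeftBraceType) :=
  Choice.copy (mult_group B) B.
HB.instance Definition _ (B : skewLeftBraceType) :=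
  isGroup.Build (mult_group B)
    (@circA B) (@circ1b B) (@circb1 B) (@circVb B) (@circbV B).
HB.instance Definition _ (B : finSkewLeftBraceType) :=
  Finite.copy (mult_group B) B.

Definition nilpotent_type (B : finSkewLeftBraceType) : Prop :=
  nilpotent [set: B].

(* Main.v *)
Require Import Defs.
From HB Require Import structures.
From mathcomp Require Import all_boot all_fingroup all_solvable.

(** Peel the tower off from the bottom.  Its lowest factor is a normal nilpotent
    Hall subgroup, so Schur-Zassenhaus presents the group as a semidirect
    product of that factor N by a copy of the rest.  The rest is, by induction,
    the multiplicative group of a skew left brace B of nilpotent type, and then
    B acts on N by automorphisms.  Adding componentwise on N x B while
    multiplying as in the semidirect product gives again a skew left brace
    ([sdprod_brace]): the multiplicative structure is twisted by the action, but
    the additive group is the direct product of N and (B,+), hence stays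
    nilpotent.

    The induction runs through the quotients G / H i of a single fixed tower,
    from i = n, where the quotient is trivial, down to i = 0; in this way the
    tower property never has to be transferred to another group. *)

Local Open Scope group_scope.

Lemma isog_mult_group {gT : finGroupType} {G : {group gT}}
    {B : finSkewLeftBraceType} {g : B -> gT} :
    injective g -> {morph g : x y / circ x y >-> x * y} ->
    g @: [set: B] = G ->
  G \isog [set: mult_group B].
Proof.
move=> g_inj gM im_g.
have gM' : {in [set: mult_group B] &, {morph (g : mult_group B -> gT)
  : x y / x * y}} by move=> x y _ _; exact: gM.
rewrite isog_sym; apply/isogP; exists (Morphism gM').
  by apply/injmP=> x y _ _; exact: g_inj.
by rewrite morphimEdom -im_g.
Qed.

Section TrivialBrace.

Context {N : finGroupType}.

Fact trivial_circDr (a b c : N) : a * (b * c) = a * b * a^-1 * (a * c).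
Proof. by rewrite -!mulgA mulKg. Qed.

Definition trivial_brace : finSkewLeftBraceType :=
  HB.pack_for finSkewLeftBraceType N
    (Group_isSkewLeftBrace.Build N
       (@mulgA N) (@mul1g N) (@mulg1 N) (@mulVg N) (@mulgV N) trivial_circDr).

End TrivialBrace.

(** The trivial skew brace on G, where both operations are the law of G, gives
    the base of the induction. *)
Lemma nilpotent_mult_group {gT : finGroupType} {G : {group gT}} :
    nilpotent G ->
  exists B : finSkewLeftBraceType,
    nilpotent_type B /\ G \isog [set: mult_group B].
Proof.
move=> nilG; exists (@trivial_brace (subg_of G)); split.
  by rewrite /nilpotent_type -(isog_nil (isog_subg G)).
apply: (@isog_mult_group _ _ (@trivial_brace (subg_of G)) sgval).
- exact: val_inj.
- by [].
- apply/setP=> x; apply/imsetP/idP=> [[y _ ->] | Gx]; first exact: subgP.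
  by exists (subg G x); rewrite ?subgK ?inE.
Qed.

(** The semidirect product of the trivial brace N by a brace B whose
    multiplicative group acts on N by automorphisms, from the left. *)
Section SemidirectBrace.

Context {N : finGroupType} {B : finSkewLeftBraceType} {act : B -> N -> N}.
Context (actM : forall b, {morph act b : m n / m * n})
        (act1 : forall n, act circ_one n = n)
        (act_circ : forall b c n, act (circ b c) n = act b (act c n)).

Definition sd_circ (x y : N * B) : N * B :=
  (x.1 * act x.2 y.1, circ x.2 y.2).
Definition sd_one : N * B := (1, circ_one).
Definition sd_inv (x : N * B) : N * B :=
  (act (circ_inv x.2) x.1^-1, circ_inv x.2).

Fact act_1 b : act b 1 = 1.
Proof. by apply: (mulgI (act b 1)); rewrite -actM !mulg1. Qed.

Fact sd_circA : associative sd_circ.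
Proof. by move=> x y z; congr pair; rewrite /= ?circA // actM act_circ mulgA. Qed.

Fact sd_circ1b : left_id sd_one sd_circ.
Proof. by case=> n b; rewrite /sd_circ /= act1 mul1g circ1b. Qed.

Fact sd_circb1 : right_id sd_one sd_circ.
Proof. by case=> n b; rewrite /sd_circ /= act_1 mulg1 circb1. Qed.

Fact sd_circVb : left_inverse sd_one sd_inv sd_circ.
Proof. by case=> n b; rewrite /sd_circ /= -actM mulVg act_1 circVb. Qed.

Fact sd_circbV : right_inverse sd_one sd_inv sd_circ.
Proof.
by case=> n b; rewrite /sd_circ /= -act_circ circbV act1 mulgV.
Qed.

(** The brace axiom says that y |-> - x + x o y is additive for every x.  Here
    this map is the automorphism [act x.2] on the component N, and on the
    component B it is the corresponding map of B. *)
Fact sd_circDr (x y z : N * B) :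
  sd_circ x (y * z) = sd_circ x y * x^-1 * sd_circ x z.
Proof.
congr pair; rewrite /= ?circDr //.
by rewrite actM -!mulgA mulKg.
Qed.

Definition sdprod_brace : finSkewLeftBraceType :=
  HB.pack_for finSkewLeftBraceType (N * B)%type
    (Group_isSkewLeftBrace.Build (N * B)%type
       sd_circA sd_circ1b sd_circb1 sd_circVb sd_circbV sd_circDr).

Lemma sdprod_brace_nilpotent :
  nilpotent [set: N] -> nilpotent_type B -> nilpotent_type sdprod_brace.
Proof.
move=> nilN nilB.
have setTX : setX [set: N] [set: B] = [set: N * B].
  by apply/setP=> x; rewrite !inE.
rewrite /nilpotent_type -[[set: sdprod_brace]]/[set: N * B] -setTX.
rewrite (dprod_nil (setX_dprod [set: N] [set: B])).
rewrite -(isog_nil (isog_setX1 B [set: N])).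
by rewrite -(isog_nil (isog_set1X N [set: B])) nilN.
Qed.

End SemidirectBrace.

(** C is a copy of the multiplicative group of B, so conjugation by C makes that
    group act on N; the isomorphism from [sdprod_brace] to G is (n, b) |-> n c,
    where c is the element of C corresponding to b. *)
Lemma sdprod_mult_group {gT : finGroupType} {G N C : {group gT}}
    {B : finSkewLeftBraceType} :
    N ><| C = G -> nilpotent N -> nilpotent_type B ->
    C \isog [set: mult_group B] ->
  exists B' : finSkewLeftBraceType,
    nilpotent_type B' /\ G \isog [set: mult_group B'].
Proof.
move=> defG nilN nilB; rewrite isog_sym => /isogP[f f_inj im_f].
have [_ _ nNC tiNC] := sdprodP defG.
pose h : B -> gT := f.
have hM b c : h (circ b c) = h b * h c.
  by apply: (morphM f (x := b) (y := c)); rewrite inE.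
have h1 : h circ_one = 1 by exact: (morph1 f).
have h_inj : injective h.
  by move=> b c eq_h; apply: (injmP f_inj); rewrite ?inE.
have Ch b : h b \in C by rewrite -im_f mem_morphim ?inE.
have im_h c : c \in C -> exists b, c = h b.
  by rewrite -im_f => /morphimP[b _ _ ->]; exists b.
(* Conjugation is a right action; the inverse turns it into the left action
   n |-> h b * n * (h b)^-1. *)
pose act b (n : subg_of N) := subg N (sgval n ^ (h b)^-1).
have actE b n : sgval (act b n) = sgval n ^ (h b)^-1.
  by rewrite subgK // memJ_norm ?subgP // groupV (subsetP nNC).
have actM b : {morph act b : m n / m * n}.
  by move=> m n; apply: val_inj; rewrite /= !actE conjMg.
have act1 n : act circ_one n = n.
  by apply: val_inj; rewrite /= actE h1 invg1 conjg1.
have act_circ b c n : act (circ b c) n = act b (act c n).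
  by apply: val_inj; rewrite /= !actE hM invMg conjgM.
exists (sdprod_brace actM act1 act_circ); split.
  by apply: sdprod_brace_nilpotent; rewrite // -(isog_nil (isog_subg N)).
pose g (x : subg_of N * B) := sgval x.1 * h x.2.
apply: (@isog_mult_group _ _ (sdprod_brace actM act1 act_circ) g).
- move=> [m b] [n c]; rewrite /g /= => eq_g.
  have [eq_mn eq_bc] : sgval m = sgval n /\ h b = h c.
    have [//|x [y [_ _ _ uniq_xy]]] := mem_sdprod defG (x := sgval m * h b).
      by rewrite -(sdprodW defG) mem_mulg ?subgP.
    have [-> ->] := uniq_xy _ _ (subgP m) (Ch b) erefl.
    by have [-> ->] := uniq_xy _ _ (subgP n) (Ch c) eq_g.
  by rewrite (h_inj _ _ eq_bc) (val_inj eq_mn).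
- move=> [m b] [n c]; rewrite /g /= actE hM conjgE invgK !mulgA.
  by rewrite mulgKV.
- apply/setP=> x; rewrite -(sdprodW defG).
  apply/imsetP/mulsgP=> [[y _ ->] | [n c Nn Cc ->]].
    by exists (sgval y.1) (h y.2); rewrite ?subgP.
  have [b ->] := im_h c Cc.
  by exists (subg N n, b); rewrite ?inE // /g /= subgK.
Qed.

(** A Schur-Zassenhaus complement of N is isomorphic to G / N, so that only the
    quotient, and no subgroup of G, need be known to come from a brace. *)
Lemma Hall_nilpotent_mult_group {gT : finGroupType} {G N : {group gT}}
    {B : finSkewLeftBraceType} :
    Hall G N -> N <| G -> nilpotent N -> nilpotent_type B ->
    G / N \isog [set: mult_group B] ->
  exists B' : finSkewLeftBraceType,
    nilpotent_type B' /\ G \isog [set: mult_group B'].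
Proof.
move=> hallN nsNG nilN nilB isoB.
have /splitsP[C complC] := SchurZassenhaus_split hallN nsNG.
have sdG : N ><| C = G.
  by apply/(sdprod_normal_complP nsNG); rewrite complgC.
apply: (sdprod_mult_group sdG nilN nilB).
exact: isog_trans (sdprod_isog sdG) isoB.
Qed.

Theorem theorem3p3 (gT : finGroupType) (G : {group gT})
    (towerG : sylow_tower_property G) :
  exists B : finSkewLeftBraceType,
    nilpotent_type B /\ G \isog [set: mult_group B].
Proof.
have [n [H [H0 Hn nsHG sHH tower]]] := towerG.
suff quoB i : i <= n -> exists B : finSkewLeftBraceType,
    nilpotent_type B /\ G / H (n - i)%N \isog [set: mult_group B].
  have [B [nilB]] := quoB n (leqnn n); rewrite subnn H0 => isoB.
  exists B; split=> //; exact: isog_trans (quotient1_isog G) isoB.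
elim: i => [_ | i IHi lt_i_n].
  apply: nilpotent_mult_group.
  by rewrite /= quotientS1 ?nilpotent1 // subn0 Hn.
have [B [nilB]] := IHi (ltnW lt_i_n).
have lt_j_n : n - i.+1 < n by rewrite subnSK // leq_subr.
rewrite -(subnSK lt_i_n); move: (n - i.+1)%N lt_j_n => j lt_j_n isoB.
have [p [P [p_pr sylP isoP]]] := tower j lt_j_n.
have [pP oP] := (pHall_pgroup sylP, card_Hall sylP).
have nsKG : H j.+1 / H j <| G / H j by rewrite quotient_normal ?nsHG.
have nilK : nilpotent (H j.+1 / H j).
  by rewrite (isog_nil isoP) (pgroup_nil pP).
have isoB' : G / H j / (H j.+1 / H j) \isog [set: mult_group B].
  by apply: isog_trans isoB; rewrite third_isog ?sHH ?nsHG // ltnW.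
apply: (Hall_nilpotent_mult_group _ nsKG nilK nilB isoB').
(* The factor carries the full p-part of #|G|, so what is left above it in the
   quotient of G has order prime to p. *)
apply: (@pHall_Hall _ p); rewrite pHallE normal_sub //=.
rewrite eqn_dvd -{1}(part_pnat_id (_ : p.-nat #|H j.+1 / H j|)) //.
  rewrite partn_dvd ?cardSg ?normal_sub //=.
  by rewrite (card_isog isoP) oP partn_dvd ?dvdn_quotient.
by rewrite (card_isog isoP).
Qed.
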